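(* Let $n\ge1$ and let $\xi\in\mathcal{F}^2_n$ be such that $(W_\xi,S)$ is an isometric Fock representation of $O_n$. Then $(W_\xi,S)$ is Nica-covariant if and only if there exists $c\in\mathbb{T}=\{z\in\mathbb{C}:|z|=1\}$ such that $\xi=c\,\Omega$.
   Context: $F_n^+$ is the free semigroup on letters $g_1,\dots,g_n$ with identity $g_0$. The Fock space is $\mathcal{F}^2_n=\mathbb{C}\Omega\oplus\bigoplus_{k\ge1}(\mathbb{C}^n)^{\otimes k}$ (complex Hilbert space) with vacuum unit vector $\Omega$; $\{e_1,\dots,e_n\}$ is the standard basis of $\mathbb{C}^n$; $e_\mu=e_{\mu_1}\otimes\cdots\otimes e_{\mu_k}$ for $\mu=g_{\mu_1}\cdots g_{\mu_k}$ and $e_{g_0}=\Omega$; the $e_\mu$ form an orthonormal basis. The creation operators are $S_if=e_i\otimes f$ on $\mathcal{F}^2_n$, $S=(S_1,\dots,S_n)$. Scalar odometer map: for $\xi\in\mathcal{F}^2_n$, $W_\xi$ is the linear map on the linear span of $\{e_\mu:\mu\in F_n^+\}$ given by $W_\xi\Omega=\xi$; $W_\xi(e_n^{\otimes m})=e_1^{\otimes m}\otimes\xi$ for $m\ge1$; and $W_\xi(e_n^{\otimes j}\otimes e_i\otimes e_\nu)=e_1^{\otimes j}\otimes e_{i+1}\otimes e_\nu$ for $j\ge0$, $1\le i\le n-1$, $\nu\in F_n^+$. When bounded, $W_\xi$ also denotes its bounded extension to $\mathcal{F}^2_n$. $(W,S)$ with $W\in\mathcal{B}(\mathcal{F}^2_n)$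 is a Fock representation of the odometer semigroup $O_n$ if $WS_i=S_{i+1}$ for $1\le i\le n-1$ and $WS_n=S_1W$; it is isometric if $W$ is an isometry. An isometric Fock representation $(W,S)$ is Nica-covariant if $W^*S_1=S_nW^*$. *)

(* Defs.v *)
From HB Require Import structures.
From mathcomp Require Import all_boot all_order all_algebra finmap.
From mathcomp Require Import all_classical all_reals all_analysis.
From mathcomp Require Import complex ring lra.

Set Implicit Arguments.
Unset Strict Implicit.
Unset Printing Implicit Defensive.

Import Order.TTheory GRing.Theory Num.Theory.
Import numFieldNormedType.Exports.
Import ComplexField.Normc.

Local Open Scope classical_set_scope.
Local Open Scope ring_scope.

(* Sum of a series of complex numbers, computed componentwise; as for [limn],
   the value is meaningful only when both real series converge. *)
Section ComplexSeries.
Variable R : realType.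
Implicit Types (u v : nat -> R[i]) (l a : R[i]).

Definition cseries u : R[i] :=
  Complex (limn (series (fun k => complex.Re (u k))))
          (limn (series (fun k => complex.Im (u k)))).

Definition csum u l : Prop :=
  series (fun k => complex.Re (u k)) @ \oo --> complex.Re l /\
  series (fun k => complex.Im (u k)) @ \oo --> complex.Im l.

Lemma csum_cseries u l : csum u l -> cseries u = l.
Proof.
case: l => x y [/= /cvg_lim hx /cvg_lim hy].
by rewrite /cseries hx // hy.
Qed.

Lemma csumD u v l a : csum u l -> csum v a -> csum (fun k => u k + v k) (l + a).
Proof.
move=> [u1 u2] [v1 v2]; split.
  rewrite raddfD /= (_ : series _ = series (fun k => complex.Re (u k)) +
                                series (fun k => complex.Re (v k))).
    exact: cvgD.
  by rewrite -seriesD; congr series; apply/funext => k; rewrite raddfD.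
rewrite raddfD /= (_ : series _ = series (fun k => complex.Im (u k)) +
                              series (fun k => complex.Im (v k))).
  exact: cvgD.
by rewrite -seriesD; congr series; apply/funext => k; rewrite raddfD.
Qed.

Lemma csumZ u l a : csum u l -> csum (fun k => a * u k) (a * l).
Proof.
case: a l => [a b] [x y] [/= u1 u2]; split => /=.
  rewrite (_ : series _ = a *: series (fun k => complex.Re (u k)) -
                          b *: series (fun k => complex.Im (u k))).
    by apply: cvgB; apply: cvgZr.
  rewrite -!seriesZ -seriesN -seriesD; congr series; apply/funext => k.
  by rewrite !fctE; case: (u k).
rewrite (_ : series _ = a *: series (fun k => complex.Im (u k)) +
                        b *: series (fun k => complex.Re (u k))).
  by apply: cvgD; apply: cvgZr.
rewrite -!seriesZ -seriesD; congr series; apply/funext => k.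
by rewrite !fctE; case: (u k).
Qed.

Lemma csumJ u l : csum u l -> csum (fun k => (u k)^*) l^*.
Proof.
case: l => [x y] [/= u1 u2]; split => /=.
  rewrite (_ : (fun k => _) = (fun k => complex.Re (u k))) //.
  by apply/funext => k; case: (u k).
rewrite (_ : series _ = - series (fun k => complex.Im (u k))); first exact: cvgN.
by rewrite -seriesN; congr series; apply/funext => k; rewrite fctE; case: (u k).
Qed.

End ComplexSeries.

Section FockSpace.
Variables (R : realType) (n : nat).

(* A vector of F^2_n is given by its coefficients in the basis (e_w), w a word
   over 'I_n (the letter g_{i+1} is the ordinal i); the words of length k index
   the basis of the summand (C^n)^{(x) k}. *)
Definition degree_sqnorm (f : seq 'I_n -> R[i]) (k : nat) : R :=
  \sum_(w : k.-tuple 'I_n) normc (f w) ^+ 2.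

Definition sqsummable : {pred seq 'I_n -> R[i]} :=
  [pred f | `[< cvgn (series (degree_sqnorm f)) >]].

Lemma degree_sqnorm_ge0 f k : 0 <= degree_sqnorm f k.
Proof. by apply: sumr_ge0 => w _; exact: sqr_ge0. Qed.

Let normcD_sq (x y : R[i]) :
  normc (x + y) ^+ 2 <= 2 * normc x ^+ 2 + 2 * normc y ^+ 2.
Proof.
case: x y => [a b] [c d] /=.
rewrite !sqr_sqrtr ?addr_ge0 ?sqr_ge0 //.
have h (u v : R) : (u + v) ^+ 2 <= 2 * u ^+ 2 + 2 * v ^+ 2.
  rewrite -subr_ge0 [X in 0 <= X](_ : _ = (u - v) ^+ 2) ?sqr_ge0 //.
  by ring.
by apply: le_trans (lerD (h _ _) (h _ _)) _; rewrite !mulrDr addrACA.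
Qed.

Lemma sqsummable_submod_closed : submod_closed sqsummable.
Proof.
split=> [|a f g /asboolP cf /asboolP cg]; apply/asboolP.
  rewrite (_ : series _ = cst 0); first exact: is_cvg_cst.
  apply/funext => k; rewrite /series /= big1 // => j _.
  by rewrite /degree_sqnorm big1 // => w _; rewrite normc0 expr0n.
apply: (@series_le_cvg _ _
  ((2 * normc a ^+ 2) *: degree_sqnorm f + 2 *: degree_sqnorm g)).
- exact: degree_sqnorm_ge0.
- move=> k; rewrite !fctE /= /GRing.scale /=.
  apply: addr_ge0; apply: mulr_ge0; rewrite ?degree_sqnorm_ge0 //.
  by rewrite mulr_ge0 ?sqr_ge0.
- move=> k; rewrite /degree_sqnorm /= !fctE /= /GRing.scale /= !mulr_sumr.
  rewrite -big_split /=; apply: ler_sum => w _.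
  by apply: le_trans (normcD_sq _ _) _; rewrite lerD2r normcM exprMn mulrA.
- by apply: is_cvg_seriesD; apply: is_cvg_seriesZ.
Qed.

HB.instance Definition _ :=
  GRing.isSubmodClosed.Build _ _ sqsummable sqsummable_submod_closed.

Record fock := Fock { fock_val :> seq 'I_n -> R[i];
                      _ : fock_val \in sqsummable }.

HB.instance Definition _ := [isSub for fock_val].
HB.instance Definition _ := [Choice of fock by <:].
HB.instance Definition _ := [SubChoice_isSubLmodule of fock by <:].

Lemma fock_cvg (f : fock) : cvgn (series (degree_sqnorm f)).
Proof. by case: f => f /= /asboolP. Qed.

Lemma fockP (f g : fock) : (forall w, f w = g w) -> f = g.
Proof. by move=> h; apply: val_inj => /=; exact: (funext h). Qed.

Lemma fockZE (a : R[i]) (f : fock) w : (a *: f) w = a * f w.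
Proof. by []. Qed.

Definition degree_dot (f g : fock) (k : nat) : R[i] :=
  \sum_(w : k.-tuple 'I_n) f w * (g w)^*.

(* Linear in the first argument; both component series converge absolutely
   (see [fdot_csum]). *)
Definition fdot (f g : fock) : R[i] := cseries (degree_dot f g).

Lemma fdot_csum f g : csum (degree_dot f g) (fdot f g).
Proof.
have cfg : cvgn (series (degree_sqnorm f + degree_sqnorm g)).
  by apply: is_cvg_seriesD; exact: fock_cvg.
have dominated (u : nat -> R) :
    (forall k, `|u k| <= (degree_sqnorm f + degree_sqnorm g) k) ->
    cvgn (series u).
  move=> hu; apply: normed_cvg; apply: series_le_cvg cfg => //= k.
  by rewrite addr_ge0 ?degree_sqnorm_ge0.
split; apply: dominated => k.
  rewrite /degree_dot raddf_sum; apply: le_trans (ler_norm_sum _ _ _) _.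
  rewrite fctE -big_split; apply: ler_sum => w _ /=.
  case: (f w) (g w) => [a b] [c d] /=.
  rewrite !sqr_sqrtr ?addr_ge0 ?sqr_ge0 // ler_norml.
  have [[h1 h2] [h3 h4]] := ((sqr_ge0 (a + c), sqr_ge0 (a - c)), (sqr_ge0 (b + d), sqr_ge0 (b - d))).
  apply/andP; split; nra.
rewrite /degree_dot raddf_sum; apply: le_trans (ler_norm_sum _ _ _) _.
rewrite fctE -big_split; apply: ler_sum => w _ /=.
case: (f w) (g w) => [a b] [c d] /=.
rewrite !sqr_sqrtr ?addr_ge0 ?sqr_ge0 // ler_norml.
have [[h1 h2] [h3 h4]] := ((sqr_ge0 (a + d), sqr_ge0 (a - d)), (sqr_ge0 (b + c), sqr_ge0 (b - c))).
apply/andP; split; nra.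
Qed.

Lemma fdotDl a f g h : fdot (a *: f + g) h = a * fdot f h + fdot g h.
Proof.
apply: csum_cseries.
rewrite (_ : degree_dot _ _ =
    fun k => a * degree_dot f h k + degree_dot g h k).
  by apply: csumD (fdot_csum _ _); apply: csumZ (fdot_csum _ _).
apply/funext => k; rewrite /degree_dot mulr_sumr -big_split.
by apply: eq_bigr => w _ /=; rewrite mulrDl -mulrA.
Qed.

Lemma fdotC f g : fdot f g = (fdot g f)^*.
Proof.
apply: csum_cseries.
rewrite (_ : degree_dot _ _ = fun k => (degree_dot g f k)^*).
  exact: csumJ (fdot_csum _ _).
apply/funext => k; rewrite /degree_dot rmorph_sum.
by apply: eq_bigr => w _; rewrite rmorphM /= conjCK mulrC.
Qed.

Lemma fdot_bilinear : bilinear_for ( *%R ) (Num.conj \; *%R) fdot.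
Proof.
split=> [h a f g | h a f g] /=; first exact: fdotDl.
by rewrite fdotC fdotDl rmorphD rmorphM /= -!fdotC.
Qed.

Lemma fdot_hermitian f g : fdot f g = (-1) ^+ false * (fdot g f)^*.
Proof. by rewrite expr0 mul1r -fdotC. Qed.

Let fdotxx f : fdot f f = (limn (series (degree_sqnorm f)))%:C%C.
Proof.
apply: csum_cseries.
have dotE k : degree_dot f f k = (degree_sqnorm f k)%:C%C.
  rewrite /degree_dot /degree_sqnorm rmorph_sum; apply: eq_bigr => w _ /=.
  case: (f w) => a b /=; rewrite sqr_sqrtr ?addr_ge0 ?sqr_ge0 //.
  by apply/eqP; rewrite eq_complex /=; apply/andP; split; apply/eqP; ring.
split => /=.
  rewrite (_ : (fun k => _) = degree_sqnorm f); first exact: fock_cvg.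
  by apply/funext => k; rewrite dotE.
rewrite (_ : series _ = cst 0); first exact: cvg_cst.
by apply/funext => k; rewrite /series /= big1 // => j _; rewrite dotE.
Qed.

Lemma fdot_gt0 (f : fock) : f != 0 -> 0 < fdot f f.
Proof.
move=> f0; have [w fw0] : exists w, f w != 0.
  apply/not_existsP => h; move/eqP: f0; apply; apply: fockP => w.
  by apply/eqP; have /negP := h w; rewrite negbK.
rewrite fdotxx ltcR.
have nd : nondecreasing_seq (series (degree_sqnorm f)).
  by apply: nondecreasing_series => k _ _; exact: degree_sqnorm_ge0.
have := nondecreasing_cvgn_le nd (@fock_cvg f) (size w).+1. apply: lt_le_trans.
rewrite /series /= big_nat_recr //=; apply: ltr_wpDl.
  by apply: sumr_ge0 => *; exact: degree_sqnorm_ge0.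
rewrite /degree_sqnorm (bigD1 (in_tuple w)) //=; apply: ltr_pwDl.
  rewrite exprn_even_gt0 //=.
  by apply: contra fw0 => /eqP /eq0_normc ->.
by apply: sumr_ge0 => v _; exact: sqr_ge0.
Qed.

HB.instance Definition _ :=
  @bilinear_isBilinear.Build R[i] fock fock R[i] _ _ fdot fdot_bilinear.
HB.instance Definition _ :=
  @isHermitianSesquilinear.Build R[i] fock false Num.conj fdot fdot_hermitian.
HB.instance Definition _ := @isDotProduct.Build R[i] fock fdot fdot_gt0.


Definition fnorm (f : fock) : R := Num.sqrt (complex.Re (fdot f f)).

Definition bounded_op (W : fock -> fock) : Prop :=
  exists M : R, forall f, fnorm (W f) <= M * fnorm f.

Definition isometric_op (W : fock -> fock) : Prop :=
  forall f, fnorm (W f) = fnorm f.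

(* [V] is the Hilbert-space adjoint W^*: for bounded linear [W] it exists by the
   Riesz theorem, is unique ([adjoint_of_unique]), and is linear and bounded. *)
Definition adjoint_of (W V : fock -> fock) : Prop :=
  forall f g, fdot (W f) g = fdot f (V g).

Lemma adjoint_of_unique W V V' : adjoint_of W V -> adjoint_of W V' -> V = V'.
Proof.
move=> adjV adjV'; apply/funext => g; apply/eqP; rewrite -subr_eq0.
apply/negPn/negP => /fdot_gt0.
rewrite linearBr /= -adjV -adjV' subrr ltxx //.
Qed.

Definition vacuum_fun (w : seq 'I_n) : R[i] := (w == [::])%:R.

Lemma vacuum_subproof : vacuum_fun \in sqsummable.
Proof.
apply/asboolP; apply: (is_cvg_near_cst (1 : R)).
exists 1%N => // k /= k0; rewrite /series /= -(prednK k0) big_nat_recl //=.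
rewrite big1_seq ?addr0 => [|j _]; last first.
  rewrite /degree_sqnorm big1 // => w _.
  by rewrite /vacuum_fun -size_eq0 size_tuple normc0 expr0n.
rewrite /degree_sqnorm (bigD1 [tuple]) //= big1 => [|w]; last by rewrite tuple0.
by rewrite addr0 sqr_sqrtr ?expr1n ?expr0n ?addr0 //= ler01.
Qed.

Definition vacuum : fock := Fock vacuum_subproof.

Definition creation_fun (i : 'I_n) (f : seq 'I_n -> R[i]) (w : seq 'I_n) : R[i] :=
  if w is j :: v then (if j == i then f v else 0) else 0.

Lemma creation_subproof i (f : fock) : creation_fun i f \in sqsummable.
Proof.
have degS k : degree_sqnorm (creation_fun i f) k.+1 = degree_sqnorm f k.
  rewrite /degree_sqnorm (bigID (fun w : k.+1.-tuple 'I_n => thead w == i)) /=.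
  rewrite [X in _ + X]big1 ?addr0 => [|w]; last first.
    case/tupleP: w => j v; rewrite theadE => /negPf ji.
    rewrite (_ : creation_fun _ _ _ = 0) ?normc0 ?expr0n //.
    by rewrite /creation_fun /= ji.
  rewrite (reindex_onto (fun v : k.-tuple 'I_n => [tuple of i :: v])
                        (fun w => behead_tuple w)) /=; last first.
    by case/tupleP => j v; rewrite theadE => /eqP ->; apply: val_inj.
  apply: eq_big => [v|v _] /=; last by rewrite eqxx.
  by rewrite theadE eqxx /=; apply/eqP; apply: val_inj.
have deg0 : degree_sqnorm (creation_fun i f) 0 = 0.
  rewrite /degree_sqnorm big1 // => w _; rewrite tuple0.
  by rewrite [creation_fun _ _ _]/creation_fun normc0 expr0n.
have shiftE : [sequence series (degree_sqnorm (creation_fun i f)) k.+1]_k =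
              series (degree_sqnorm f).
  apply/funext => k; rewrite /series /= big_nat_recl // deg0 add0r.
  by apply: eq_bigr => j _; exact: degS.
apply/asboolP; apply/cvg_ex; exists (limn (series (degree_sqnorm f))).
by rewrite -cvg_shiftS shiftE; exact: fock_cvg.
Qed.

(* f |-> e_i (x) f *)
Definition creation (i : 'I_n) (f : fock) : fock := Fock (creation_subproof i f).

(* f |-> e_w (x) f, where e_[::] (x) f = f *)
Definition word_creation (w : seq 'I_n) (f : fock) : fock := foldr creation f w.

Definition fbasis (w : seq 'I_n) : fock := word_creation w vacuum.

Lemma fbasisE w v : fbasis w v = (v == w)%:R.
Proof.
elim: w v => [|i w ih] [|j v] //=; rewrite eqseq_cons.
by case: eqP => //= _; exact: ih.
Qed.

Definition algebraic_span : set fock :=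
  [set f | finite_set [set w | f w != 0]].

Lemma algebraic_spanE f : f \in algebraic_span ->
  f = \sum_(w \in [set: seq 'I_n]) f w *: fbasis w.
Proof.
rewrite inE => /finite_fsetP [X suppX].
have XP w : w \notin X -> f w = 0.
  move=> wX; apply/eqP; apply: contraNT wX => fw0.
  by have : [set` X] w by rewrite -suppX.
rewrite (fsbigTE X) => [|w /XP ->]; last by rewrite scale0r.
apply: fockP => v.
have sumE (r : seq (seq 'I_n)) (F : seq 'I_n -> fock) :
    (\sum_(w <- r) F w) v = \sum_(w <- r) F w v.
  by elim: r => [|w r ih]; rewrite ?big_nil ?big_cons //= -ih.
rewrite sumE; have [vX|vX] := boolP (v \in X).
  rewrite (big_fsetD1 v) // fockZE fbasisE eqxx mulr1 big1_seq.
    exact/esym/addr0.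
  move=> w; rewrite in_fsetD1 => /andP[_ /andP[wv _]].
  by rewrite fockZE fbasisE eq_sym (negPf wv) mulr0.
rewrite XP // big1_seq // => w /andP[_ wX].
rewrite fockZE fbasisE; case: eqP => [vw|]; last by rewrite mulr0.
by rewrite vw wX in vX.
Qed.

Lemma fbasis_span w : fbasis w \in algebraic_span.
Proof.
rewrite inE; apply: (sub_finite_set _ (finite_set1 w)) => v /=.
by rewrite fbasisE; case: (v =P w) => //; rewrite eqxx.
Qed.

End FockSpace.

Arguments vacuum {R n}.
Arguments fbasis {R n} w.
Arguments algebraic_span {R n}.

Section Odometer.
Variables (R : realType) (n : nat).
Local Notation F2 := (fock R n.+1).

(* W_xi e_w, by recursion on leading letters g_n; the defining formulas for
   e_n^{(x) m} and e_n^{(x) j} (x) e_i (x) e_v are the lemmas below. *)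
Fixpoint odometer_basis (xi : F2) (w : seq 'I_n.+1) : F2 :=
  if w is i :: v then
    if i == ord_max then creation ord0 (odometer_basis xi v)
    else fbasis (inord i.+1 :: v)
  else xi.

Lemma odometer_basis_nil xi : odometer_basis xi [::] = xi.
Proof. by []. Qed.

Lemma odometer_basis_nseq xi m :
  odometer_basis xi (nseq m ord_max) = word_creation (nseq m ord0) xi.
Proof. by elim: m => //= m ->; rewrite eqxx. Qed.

Lemma odometer_basis_cat xi j (i i' : 'I_n.+1) v : i' = i.+1 :> nat ->
  odometer_basis xi (nseq j ord_max ++ i :: v) =
  fbasis (nseq j ord0 ++ i' :: v).
Proof.
move=> ii'; elim: j => [|j ih] /=; last by rewrite eqxx ih.
case: eqP => [imax|_]; first by have := ltn_ord i'; rewrite ii' imax ltnn.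
by congr (fbasis (_ :: v)); apply: val_inj; rewrite /= ii' inordK // -ii'.
Qed.

(* The finitely supported sum is meaningful for f in [algebraic_span]. *)
Definition odometer_map (xi f : F2) : F2 :=
  \sum_(w \in [set: seq 'I_n.+1]) f w *: odometer_basis xi w.

Definition bounded_extension (xi : F2) (W : {linear F2 -> F2}) : Prop :=
  bounded_op W /\ (forall f, f \in algebraic_span -> W f = odometer_map xi f).

Lemma bounded_extensionP xi (W : {linear F2 -> F2}) :
  bounded_extension xi W <->
  bounded_op W /\ (forall w, W (fbasis w) = odometer_basis xi w).
Proof.
split=> -[bW hW]; split=> //; [move=> w | move=> f fspan].
  rewrite hW ?fbasis_span // /odometer_map (fsbigTE [fset w]%fset) => [|v].
    by rewrite big_seq_fset1 fbasisE eqxx scale1r.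
  by rewrite inE fbasisE => /negPf ->; rewrite scale0r.
rewrite [in LHS](algebraic_spanE fspan) /odometer_map.
move: fspan; rewrite inE => /finite_fsetP [X suppX].
have XP w : w \notin X -> f w = 0.
  move=> wX; apply/eqP; apply: contraNT wX => fw0.
  by have : [set` X] w by rewrite -suppX.
rewrite !(fsbigTE X) => [|w /XP ->|w /XP ->]; rewrite ?scale0r //.
by rewrite linear_sum; apply: eq_bigr => w _; rewrite linearZ /= hW.
Qed.

Definition fock_representation (W : {linear F2 -> F2}) : Prop :=
  bounded_op W /\
  (forall i j : 'I_n.+1, j = i.+1 :> nat ->
     forall f, W (creation i f) = creation j f) /\
  (forall f, W (creation ord_max f) = creation ord0 (W f)).

Definition isometric_fock_representation (W : {linear F2 -> F2}) : Prop :=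
  fock_representation W /\ isometric_op W.

Definition nica_covariant (W : {linear F2 -> F2}) : Prop :=
  exists V : F2 -> F2, adjoint_of W V /\
    (forall f, V (creation ord0 f) = creation ord_max (V f)).

End Odometer.

(* Main.v *)
(* Write [S_i] for the creation operators. Every [f] is uniquely
   [f [::] *: vacuum + \sum_i S_i f_i]. If [W^* S_1 = S_n W^*], then
   [<xi, S_1 g> = <vacuum, S_n W^* g> = 0], while for [i > 1] the isometry of
   [W] gives [<xi, S_i g> = <W vacuum, W S_(i-1) g> = <vacuum, S_(i-1) g> = 0];
   hence [xi] is a multiple of the vacuum. Conversely, if [xi = c *: vacuum],
   then [W] permutes the words of each length up to a phase, and its adjoint is
   the inverse odometer [W^* S_(i+1) = S_i], [W^* S_1 = S_n W^*],
   [W^* vacuum = c^* *: vacuum]. *)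
Require Import Defs.
From mathcomp Require Import all_boot all_order all_algebra.
From mathcomp Require Import all_classical all_reals all_analysis.
From mathcomp Require Import complex.
Import Order.TTheory GRing.Theory Num.Theory.
Import numFieldNormedType.Exports.
Import ComplexField.Normc.
Local Open Scope ring_scope.

(** Drives the inductions on degree below. [F] takes sequences, so that [i :: v] needs no cast
    between tuple types. *)
Lemma sum_tupleS (V : nmodType) (T : finType) (k : nat) (F : seq T -> V) :
  \sum_(w : k.+1.-tuple T) F w = \sum_i \sum_(v : k.-tuple T) F (i :: v).
Proof.
rewrite pair_big /=.
rewrite (reindex (fun p : T * k.-tuple T => [tuple of p.1 :: p.2])) //=.
exists (fun w => (thead w, behead_tuple w)) => [[i v] _|w _] /=.
  by rewrite theadE; congr pair; apply: val_inj.
by case/tupleP: w => j v; apply: val_inj; rewrite /= theadE.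
Qed.

(** * Annihilation operators, orthogonality and polarization *)

Section Annihilation.
Local Set Implicit Arguments.
Local Unset Strict Implicit.
Local Open Scope classical_set_scope.
Variables (R : realType) (n : nat).
Implicit Types (f g : fock R n) (i : 'I_n).

Lemma csum0 : @csum R (fun=> 0) 0.
Proof.
suff h : @series R (fun=> 0) @ \oo --> (0 : R) by split.
rewrite (_ : series _ = cst 0); first exact: cvg_cst.
by apply/funext => k; rewrite /series /= big1.
Qed.

Lemma fdot_ge0 f : 0 <= fdot f f.
Proof.
have [->|/fdot_gt0/ltW//] := eqVneq f 0.
by rewrite linear0r.
Qed.

(** Degree [k] of the new family is one first-letter block of degree [k.+1] of [f], so comparison
    with the shifted series applies. *)
Lemma annihilation_subproof i f : (fun v => f (i :: v)) \in @sqsummable R n.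
Proof.
apply/asboolP.
apply: (@series_le_cvg _ _ (fun k => degree_sqnorm f k.+1)).
- by move=> k; exact: degree_sqnorm_ge0.
- by move=> k; exact: degree_sqnorm_ge0.
- move=> k; rewrite /degree_sqnorm.
  rewrite (sum_tupleS _ _ _ (fun w => normc (f w) ^+ 2)) (bigD1 i) //= lerDl.
  by do 2![apply: sumr_ge0 => ? _]; exact: sqr_ge0.
rewrite (_ : series _ = fun k =>
  series (degree_sqnorm f) k.+1 - degree_sqnorm f 0); last first.
  apply/funext => k; rewrite /series /= big_nat_recl //.
  by rewrite addrAC subrr add0r.
apply: is_cvgB; last exact: is_cvg_cst.
apply/cvg_ex; exists (limn (series (degree_sqnorm f))).
by rewrite (cvg_shiftS (series (degree_sqnorm f))); exact: fock_cvg.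
Qed.

(** The left annihilation operator, classically the adjoint of [creation i]. *)
Definition annihilation i f : fock R n := Fock (annihilation_subproof i f).

Lemma fockDE f g w : (f + g) w = f w + g w.
Proof. by []. Qed.

Lemma fock_sumE (I : finType) (F : I -> fock R n) w :
  (\sum_i F i) w = \sum_i F i w.
Proof. exact: (big_morph (fun f : fock R n => f w)). Qed.

Lemma fock_decomposition f :
  f = f [::] *: vacuum + \sum_i creation i (annihilation i f).
Proof.
apply: fockP => w; rewrite fockDE fock_sumE fockZE.
case: w => [|i v] /=.
  by rewrite big1 // /vacuum_fun eqxx mulr1 addr0.
rewrite /vacuum_fun /= mulr0 add0r (bigD1 i) //= eqxx big1 ?addr0 // => j.
by rewrite eq_sym => /negPf ->.
Qed.

Lemma fdot_vacuum_creation i g : fdot vacuum (creation i g) = 0.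
Proof.
apply: csum_cseries.
rewrite (_ : degree_dot _ _ = fun=> 0); first exact: csum0.
apply/funext => k; rewrite /degree_dot big1 // => w _.
by case: (tval w) => [|j v] /=; rewrite ?rmorph0 ?mulr0 // mul0r.
Qed.

(** [fnorm] sees only the square root of a real part; positivity of [fdot f f] makes its imaginary
    part zero and the square root injective. *)
Lemma isometric_fdot_diag (W : fock R n -> fock R n) : isometric_op W ->
  forall f, fdot (W f) (W f) = fdot f f.
Proof.
move=> isoW f; have := isoW f; rewrite /fnorm.
move: (fdot_ge0 f) (fdot_ge0 (W f)).
case: (fdot f f) (fdot (W f) (W f)) => [a b] [c d].
rewrite !lecE /= => /andP[/eqP -> a0] /andP[/eqP -> c0] /eqP.
by rewrite eqr_sqrt // => /eqP ->.
Qed.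

(** Polarization: the norms of [f + g] and of ['i *: f + g] determine the sum and the difference of
    [fdot f g] and [fdot g f]. *)
Lemma isometric_fdot (W : {linear fock R n -> fock R n}) : isometric_op W ->
  forall f g, fdot (W f) (W g) = fdot f g.
Proof.
move=> isoW f g; have diag := isometric_fdot_diag isoW.
have real_part f' g' : fdot (W f') (W g') + fdot (W g') (W f') =
                       fdot f' g' + fdot g' f'.
  have := diag (f' + g'); rewrite linearD !linearDl !linearDr /= !diag.
  by rewrite -!addrA => /addrI; rewrite !addrA => /addIr.
have := real_part ('i *: f) g.
rewrite linearZ /= !linearZl_LR !linearZr_LR /= conjCi !mulNr -!mulrBr.
move/(mulfI (neq0Ci _)) => imag_part.
have two_neq0 : (2 : R[i]) != 0 by rewrite pnatr_eq0.
apply: (mulfI two_neq0); rewrite !mulr_natl !mulr2n.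
have := congr2 +%R (real_part f g) imag_part.
by rewrite !addrA ![_ + _ + _ - _]addrAC !addrK.
Qed.
End Annihilation.

(** * The inverse odometer as the adjoint of [W] *)

Section InverseOdometer.
Local Set Implicit Arguments.
Local Unset Strict Implicit.
Variables (R : realType) (n : nat).
Local Notation F2 := (fock R n.+1).
Implicit Types (f g : F2) (c : R[i]) (W : {linear F2 -> F2}).

(** Reindexing by the cyclic shift of the letters, which is how the odometer acts on a leading
    letter. *)
Lemma eq_sum_cyclic (V : nmodType) (F G : 'I_n.+1 -> V) :
  F ord_max = G ord0 ->
  (forall i j : 'I_n.+1, j = i.+1 :> nat -> F i = G j) ->
  \sum_i F i = \sum_i G i.
Proof.
move=> FG0 FGS; rewrite big_ord_recr big_ord_recl /= FG0 addrC; congr +%R.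
by apply: eq_bigr => i _; exact: FGS.
Qed.

(** The coefficient at [w] is the inner product of [g] with the odometer image of the basis vector
    of [w]. Each leading [ord_max] is a carry, absorbed by stripping [ord0] from the argument of
    [g]. *)
Fixpoint inverse_odometer_fun c (g : seq 'I_n.+1 -> R[i]) (w : seq 'I_n.+1) :
    R[i] :=
  if w is i :: v then
    if i == ord_max then inverse_odometer_fun c (fun u => g (ord0 :: u)) v
    else g (inord i.+1 :: v)
  else c^* * g [::].

Lemma inverse_odometer_funS c (g : seq 'I_n.+1 -> R[i]) (i j : 'I_n.+1) v :
  j = i.+1 :> nat -> inverse_odometer_fun c g (i :: v) = g (j :: v).
Proof.
move=> ij /=; rewrite -ij inord_val.
by case: eqP => // imax; have := ltn_ord j; rewrite ij imax ltnn.
Qed.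

(** Induction on the degree with [g] general: the [ord_max] block is the carry and falls under the
    induction hypothesis, the other blocks are relabelled, and [c] enters only through its
    modulus. *)
Lemma degree_sqnorm_inverse_odometer_fun c (g : seq 'I_n.+1 -> R[i]) :
  `|c| = 1 -> degree_sqnorm (inverse_odometer_fun c g) = degree_sqnorm g.
Proof.
move=> c1; have normcc : normc c^* = 1.
  by have := norm_conjC c; rewrite c1 => -[].
apply/funext => k; elim: k g => [|k IHk] g; rewrite /degree_sqnorm.
  apply: eq_bigr => w _; rewrite tuple0 /=.
  by rewrite normcM normcc mul1r.
rewrite (sum_tupleS _ _ _ (fun w => normc (g w) ^+ 2)).
rewrite (sum_tupleS _ _ _ (fun w => normc (inverse_odometer_fun c g w) ^+ 2)).
apply: eq_sum_cyclic => [|i j ij].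
  by rewrite -[RHS](IHk (fun u => g (ord0 :: u))) /= eqxx.
by apply: eq_bigr => v _; rewrite (inverse_odometer_funS _ _ _ ij).
Qed.

Lemma inverse_odometer_subproof c (c1 : `|c| = 1) g :
  inverse_odometer_fun c g \in @sqsummable R n.+1.
Proof.
apply/asboolP; rewrite degree_sqnorm_inverse_odometer_fun //.
exact: fock_cvg.
Qed.

Definition inverse_odometer c (c1 : `|c| = 1) g : F2 :=
  Fock (inverse_odometer_subproof c1 g).

Lemma inverse_odometer_creation c (c1 : `|c| = 1) g :
  inverse_odometer c1 (creation ord0 g) =
  creation ord_max (inverse_odometer c1 g).
Proof.
apply: fockP => -[|i v] /=; first by rewrite mulr0.
case: eqP => [_|imax].
  by congr inverse_odometer_fun; apply/funext => u; rewrite eqxx.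
(* As [i] is not the last letter, [inord i.+1] is a true successor, hence not [ord0], and both sides
   vanish. *)
rewrite -val_eqE /= inordK // ltnS ltn_neqAle -ltnS ltn_ord andbT.
by apply/eqP => iE; apply: imax; exact: val_inj.
Qed.

Lemma ord_succP (i : 'I_n.+1) :
  i = ord_max \/ exists j : 'I_n.+1, j = i.+1 :> nat.
Proof.
have [->|imax] := eqVneq i ord_max; first by left.
right; exists (inord i.+1); rewrite inordK // ltnS ltn_neqAle -ltnS ltn_ord.
by rewrite andbT; apply: contra imax => /eqP iE; apply/eqP; exact: val_inj.
Qed.

(** * Coefficients of [W f] when [W] preserves the vacuum line *)

Section Representation.
Variables (W : {linear F2 -> F2}) (c : R[i]).
Hypothesis repW : fock_representation W.
Hypothesis W_vacuum : W vacuum = c *: vacuum.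

(** Splitting [f] by first letter is a finite sum, so linearity carries [W] through it; the next
    lemmas find which summand survives at a given word. *)
Lemma representation_coefE f w :
  W f w = c * f [::] * vacuum w +
    \sum_i W (creation i (annihilation i f)) w.
Proof.
rewrite {1}(fock_decomposition f) linearD linearZ linear_sum.
rewrite fockDE fock_sumE fockZE W_vacuum fockZE mulrA.
by congr (_ * _ + _); rewrite mulrC.
Qed.

Lemma representation_coef_nil f : W f [::] = c * f [::].
Proof.
have [_ [WS Wmax]] := repW.
rewrite representation_coefE /= /vacuum_fun eqxx mulr1 big1 ?addr0 // => i _.
by have [->|[j ij]] := ord_succP i; rewrite ?Wmax // (WS _ _ ij).
Qed.

(** Only the carry relation for [ord_max] produces a leading [ord0]. *)
Lemma representation_coef0 f v :
  W f (ord0 :: v) = W (annihilation ord_max f) v.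
Proof.
have [_ [WS Wmax]] := repW.
rewrite representation_coefE /= /vacuum_fun mulr0 add0r (bigD1 ord_max) //=.
rewrite Wmax /= big1 ?addr0 // => i; have [->|[j ij]] := ord_succP i.
  by rewrite eqxx.
by rewrite (WS _ _ ij) /= (_ : (ord0 == j) = false) // -val_eqE /= ij.
Qed.

Lemma representation_coefS f (i j : 'I_n.+1) v : j = i.+1 :> nat ->
  W f (j :: v) = f (i :: v).
Proof.
move=> ij; have [_ [WS Wmax]] := repW.
rewrite representation_coefE /= /vacuum_fun mulr0 add0r (bigD1 i) //=.
rewrite (WS _ _ ij) /= eqxx big1 ?addr0 // => k ki.
have [->|[l kl]] := ord_succP k.
  by rewrite Wmax /= (_ : (j == ord0) = false) // -val_eqE /= ij.
rewrite (WS _ _ kl) /= (_ : (j == l) = false) //.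
by apply: contraNF ki; rewrite -!val_eqE /= ij kl eqSS eq_sym.
Qed.

(** The pairings already agree in each degree, so the claim is a finite identity proved by induction
    on the degree. *)
Lemma adjoint_inverse_odometer (c1 : `|c| = 1) :
  adjoint_of W (inverse_odometer c1).
Proof.
suff degE k f g : degree_dot (W f) g k = degree_dot f (inverse_odometer c1 g) k.
  by move=> f g; rewrite /fdot; congr cseries; apply/funext => k.
elim: k f g => [|k IHk] f g; rewrite /degree_dot.
  apply: eq_bigr => w _; rewrite tuple0 /= representation_coef_nil.
  by rewrite rmorphM /= conjCK mulrA (mulrC c).
rewrite (sum_tupleS _ _ _ (fun w => W f w * (g w)^*)).
rewrite (sum_tupleS _ _ _ (fun w => f w * (inverse_odometer c1 g w)^*)).
apply/esym/eq_sum_cyclic => [|i j ij].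
  (* The carry block: [ord_max] in [f] meets [ord0] in [g], one degree lower. *)
  transitivity (degree_dot (W (annihilation ord_max f)) (annihilation ord0 g) k).
    by rewrite IHk; apply: eq_bigr => v _; rewrite /= eqxx.
  by apply: eq_bigr => v _; rewrite representation_coef0.
apply: eq_bigr => v _; rewrite (representation_coefS _ _ ij).
by rewrite [inverse_odometer c1 g _](inverse_odometer_funS _ _ _ ij).
Qed.

End Representation.

Lemma nica_covariant_vacuum_image W : isometric_fock_representation W ->
  nica_covariant W -> W vacuum = W vacuum [::] *: vacuum.
Proof.
move=> [[_ [WS _]] isoW] [V [adjV nicaV]].
have orth i g : fdot (W vacuum) (creation i g) = 0.
  have [->|[j ij]] : i = ord0 \/ exists j : 'I_n.+1, i = j.+1 :> nat.
    case: (unliftP ord0 i) => [j ->|->]; last by left.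
    by right; exists (widen_ord (leqnSn n) j).
  - by rewrite adjV nicaV fdot_vacuum_creation.
  - by rewrite -(WS _ _ ij) isometric_fdot // fdot_vacuum_creation.
have := fock_decomposition (W vacuum).
set xi := W vacuum; set r := \sum_i _ => xiE.
suff r0 : r = 0 by rewrite {1}xiE r0 addr0.
(* Only the first argument of [fdot r r] is rewritten; the second stays a sum of creations, to which
   [xi] and [vacuum] are both orthogonal. *)
apply/eqP/negPn/negP => /fdot_gt0; rewrite {1}(_ : r = xi - xi [::] *: vacuum).
  rewrite linearBl linearZl_LR !linear_sumr /= !big1 ?mulr0 ?subrr ?ltxx // => i _.
  exact: fdot_vacuum_creation.
by rewrite {1}xiE addrAC subrr add0r.
Qed.

Lemma isometric_vacuum_phase W c : isometric_op W ->
  W vacuum = c *: vacuum -> `|c| = 1.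
Proof.
move=> isoW Wvac; have := isometric_fdot isoW vacuum vacuum.
rewrite Wvac linearZl_LR linearZr_LR /= mulrA -normCK.
have vac_neq0 : fdot (@vacuum R n.+1) vacuum != 0.
  apply/lt0r_neq0/fdot_gt0/eqP => /(congr1 (fun f : F2 => f [::])).
  by rewrite /= /vacuum_fun eqxx; exact/eqP/oner_neq0.
rewrite -[RHS]mul1r => /(mulIf vac_neq0)/eqP.
by rewrite sqrp_eq1 // => /eqP.
Qed.

End InverseOdometer.

(* There are n.+1 letters, so every number of letters >= 1 is covered. *)
Theorem corollary4p6 (R : realType) (n : nat) (xi : fock R n.+1)
    (W : {linear fock R n.+1 -> fock R n.+1}) :
  bounded_extension xi W ->
  isometric_fock_representation W ->
  (nica_covariant W <-> exists c : R[i], `|c| = 1 /\ xi = c *: vacuum).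
Proof.
(* At the empty word the basis formula reads [W vacuum = xi]. *)
move=> /bounded_extensionP[_ /(_ [::])/= Wvac] isorepW.
have [repW isoW] := isorepW; rewrite -Wvac; split=> [nicaW|[c [c1 Wc]]].
  have Wvac_line := nica_covariant_vacuum_image isorepW nicaW.
  (* Unification chooses the phase [W vacuum [::]]. *)
  by eexists; split; [exact: isometric_vacuum_phase Wvac_line|exact: Wvac_line].
exists (inverse_odometer c1); split; first exact: adjoint_inverse_odometer.
exact: inverse_odometer_creation.
Qed.
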